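(* For all $n\in\mathbb{N}$, the multiplicative semigroup $M_n(\mathbb{T}_{[1,2]})$ of $n\times n$ matrices over $\mathbb{T}_{[1,2]}$ is strongly permutable.
   Context: $\mathbb{N}$ denotes the natural numbers excluding $0$. $\mathbb{T}_{[1,2]}$ is the semiring with underlying set $[1,2]\cup\{0,-\infty\}$ ($[1,2]$ the real interval), with maximum as addition and truncated addition $(a,b)\mapsto\min(a+b,2)$ as multiplication ($+$ classical, $-\infty+a=-\infty$). Matrix multiplication is induced from these operations in the usual way. A semigroup $T$ is strongly permutable (or permutable) if there exists $k\geq 2$ such that for all $s_1,\dots,s_k\in T$ there is a non-identity permutation $\sigma$ of $\{1,\dots,k\}$ with $s_{\sigma(1)}\cdots s_{\sigma(k)}=s_1\cdots s_k$. *)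

(* Defs.v *)
From HB Require Import structures.
From mathcomp Require Import all_boot all_order all_algebra all_fingroup.
From mathcomp Require Import reals constructive_ereal.

Set Implicit Arguments.
Unset Strict Implicit.
Unset Printing Implicit Defensive.

Import Order.TTheory GRing.Theory Num.Theory.

Local Open Scope ereal_scope.

Section Trop12.
Variable R : realType.

Definition in_trop12 (x : \bar R) : bool :=
  [|| x == -oo, x == 0 | (1%:E <= x) && (x <= 2%:E)].

Record trop12 := Trop12 {
  trop12_val :> \bar R;
  trop12_valP : in_trop12 trop12_val
}.

HB.instance Definition _ := [isSub for trop12_val].
HB.instance Definition _ := [Choice of trop12 by <:].

Lemma in_trop12_Ny : in_trop12 -oo. Proof. by rewrite /in_trop12 eqxx. Qed.

Lemma in_trop12_0 : in_trop12 0.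
Proof. by rewrite /in_trop12 eqxx orbT. Qed.

Lemma in_trop12_max x y :
  in_trop12 x -> in_trop12 y -> in_trop12 (maxe x y).
Proof. by case: (leP x y). Qed.

Lemma in_trop12_ge0 x : in_trop12 x -> x = -oo \/ (0 <= x <= 2%:E).
Proof.
case/or3P => [/eqP->|/eqP->|/andP[x1 x2]]; [by left|right|right].
  by rewrite lexx lee_fin ler0n.
by rewrite x2 andbT (le_trans _ x1)// lee_fin ler01.
Qed.

Lemma in_trop12_mul x y :
  in_trop12 x -> in_trop12 y -> in_trop12 (mine (x + y) 2%:E).
Proof.
have one_two : (1%:E : \bar R) <= 2%:E by rewrite lee_fin ler1n.
move=> xT yT.
have [-> //|/andP[y0 y2]] := in_trop12_ge0 yT.
  by rewrite addeNy minNye.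
case/or3P: xT => [/eqP->|/eqP->|/andP[x1 x2]].
- by rewrite addNye minNye.
- by rewrite add0e min_l.
- apply/or3P/Or33; rewrite ge_min lexx orbT andbT le_min one_two andbT.
  by rewrite -[leLHS]adde0 leeD.
Qed.

Definition trop12_zero : trop12 := @Trop12 -oo in_trop12_Ny.
Definition trop12_one : trop12 := @Trop12 0 in_trop12_0.
Definition trop12_add (x y : trop12) : trop12 :=
  Trop12 (in_trop12_max (trop12_valP x) (trop12_valP y)).
Definition trop12_mul (x y : trop12) : trop12 :=
  Trop12 (in_trop12_mul (trop12_valP x) (trop12_valP y)).

Lemma trop12_addA : associative trop12_add.
Proof. by move=> x y z; apply/val_inj; rewrite /= maxA. Qed.

Lemma trop12_addC : commutative trop12_add.
Proof. by move=> x y; apply/val_inj; rewrite /= maxC. Qed.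

Lemma trop12_add0 : left_id trop12_zero trop12_add.
Proof. by move=> x; apply/val_inj; rewrite /= maxNye. Qed.

Lemma trop12_mulC : commutative trop12_mul.
Proof. by move=> x y; apply/val_inj; rewrite /= addeC. Qed.

Lemma trop12_mulA : associative trop12_mul.
Proof.
have aux (x y z : trop12) :
    mine (mine (x + y) 2%:E + z) 2%:E = mine (x + y + z) 2%:E.
  have [->|/andP[z0 _]] := in_trop12_ge0 (trop12_valP z).
    by rewrite !addeNy.
  have two : (2%:E : \bar R) <= 2%:E + z by rewrite -[leLHS]adde0 leeD.
  case: (leP (x + y) 2%:E) => // xy2.
  by rewrite !min_r// (le_trans two)// leeD// ltW.
move=> x y z; apply/val_inj => /=.
by rewrite aux addeC (aux y z x) addeC addeA.
Qed.

Lemma trop12_mul1 : left_id trop12_one trop12_mul.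
Proof.
move=> x; apply/val_inj; rewrite /= add0e min_l//.
by have [->|/andP[]] := in_trop12_ge0 (trop12_valP x); rewrite ?leNye.
Qed.

Lemma trop12_mulDl : left_distributive trop12_mul trop12_add.
Proof.
by move=> x y z; apply/val_inj; rewrite /= adde_maxl min_maxl.
Qed.

Lemma trop12_mul0 : left_zero trop12_zero trop12_mul.
Proof. by move=> x; apply/val_inj; rewrite /= addNye minNye. Qed.

Lemma trop12_oner_neq0 : trop12_one != trop12_zero.
Proof. by []. Qed.

HB.instance Definition _ :=
  GRing.isNmodule.Build trop12 trop12_addA trop12_addC trop12_add0.
HB.instance Definition _ :=
  GRing.Nmodule_isComNzSemiRing.Build trop12 trop12_mulA trop12_mulC
    trop12_mul1 trop12_mulDl trop12_mul0 trop12_oner_neq0.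

End Trop12.

(* The product s 0 * s 1 * ... * s k, taken without reference to an identity
   element since a semigroup need not have one. *)
Definition sgprod (T : Type) (op : SemiGroup.law T) (k : nat)
    (s : 'I_k.+1 -> T) : T :=
  foldl op (s ord0) [seq s (lift ord0 i) | i <- enum 'I_k].

(* The number of factors is k.+2, which ranges over the integers >= 2. *)
Definition strongly_permutable (T : Type) (op : SemiGroup.law T) : Prop :=
  exists k : nat, forall s : 'I_k.+2 -> T,
    exists2 sigma : 'S_k.+2, sigma != 1%g &
      sgprod op (s \o sigma) = sgprod op s.

Arguments strongly_permutable : clear implicits.

(* Main.v *)
Require Import Defs.
From mathcomp Require Import all_boot all_order all_algebra all_fingroup.
From mathcomp Require Import reals constructive_ereal lra.

(** Call the profile of a matrix the table recording, for each entry, whether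
it is at least 0, at least 1 and at least 2. There are finitely many profiles,
and having the same profile is a congruence of the multiplicative monoid of
matrices ([profile_mul]).

Cut a long product of matrices at every position and record the profiles of
the prefix and of the suffix. By the pigeonhole principle three cuts give the
same pair of profiles, so the product reads u x y v with x and y nonempty,
where right multiplication of u by x or by y preserves its profile, and so
does left multiplication of v by x or by y. Exchanging the factors of x with
those of y is a nontrivial permutation ([strongly_permutable_of_swap]).

It remains to see that u x y v = u y x v ([swap_le], used in both directions).
The two products have the same profile, so they agree on entries equal to
-oo, 0 or 2. An entry strictly between is the weight of a best walk through
the four matrices; as two factors taken in [1, 2] already give 2, such a walk
has at most one step of nonzero weight. If that step lies in x, say from p to
q, then p is reached with weight 0 by an entry of u, and q is left with weight
0 by an entry of y v. As u y has the profile of u, and v that of y v, the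
entries of u y leading to p and of v leaving q are at least 0, so the step in
x gives a walk of at least the same weight in u y x v. The same transfer works
when the step lies in y, u or v. *)

Set Implicit Arguments.
Unset Strict Implicit.
Unset Printing Implicit Defensive.

Import Order.TTheory GRing.Theory Num.Theory.

Local Open Scope ring_scope.

(** * Permutability from a finite congruence *)

(** Each of the [(size l).+1] cuts of [l] into a prefix and a suffix gets a
colour, and some colour occurs three times as soon as there are more than
[2 * #|C|] cuts. *)
Lemma three_equal_cuts (T : Type) (C : finType) (f : seq T -> seq T -> C)
    (l : seq T) : (2 * #|C| <= size l)%N ->
  exists u x y v : seq T,
    [/\ l = u ++ x ++ y ++ v, (0 < size x)%N, (0 < size y)%N,
        f (u ++ x) (y ++ v) = f u (x ++ y ++ v) &
        f (u ++ x ++ y) v = f u (x ++ y ++ v)].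
Proof.
move=> lC; pose g t := f (take t l) (drop t l).
pose cuts := iota 0 (size l).+1.
have [c c3] : exists c, (2 < count (fun t => g t == c) cuts)%N.
  apply/existsP; apply: contraLR lC; rewrite negb_exists => /forallP c2.
  (* Each colour class has at most two cuts: count the cuts by colour. *)
  rewrite -ltnNge -[(size l).+1](size_iota 0) -/cuts.
  have -> : size cuts = (\sum_(c : C) count (fun t => g t == c) cuts)%N.
    under eq_bigr do rewrite -sum1_count.
    rewrite (exchange_big_dep xpredT)// -(sum1_size cuts).
    apply: eq_bigr => t _.
    by rewrite (big_pred1 (g t)) // => c0; rewrite /= eq_sym.
  rewrite mulnC -sum_nat_const; apply: leq_sum => c _.
  by rewrite leqNgt c2.
(* Filtering [iota] keeps the cuts sorted, so the first three satisfy
   t1 < t2 < t3. *)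
have := filter_all (fun t => g t == c) cuts.
have := sorted_filter ltn_trans (fun t => g t == c)
  (iota_ltn_sorted 0 (size l).+1).
have sub t : t \in filter (fun t => g t == c) cuts -> (t <= size l)%N.
  by rewrite mem_filter mem_iota => /andP[].
move: c3 sub; rewrite -size_filter -/cuts.
case: (filter _ _) => [|t1 [|t2 [|t3 r]]] //= _ sub /and3P[t12 t23 _].
move=> /and4P[/eqP g1 /eqP g2 /eqP g3 _].
have t3l : (t3 <= size l)%N.
  by apply: sub; rewrite !inE eqxx !orbT.
exists (take t1 l), (take (t2 - t1) (drop t1 l)),
  (take (t3 - t2) (drop t2 l)), (drop t3 l).
have cut a b : (a <= b)%N -> take a l ++ take (b - a) (drop a l) = take b l.
  by move=> ab; rewrite -takeD subnKC.
have cut' a b : (a <= b)%N -> take (b - a) (drop a l) ++ drop b l = drop a l.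
  by move=> ab; rewrite -{2}(subnK ab) -drop_drop cat_take_drop.
have [le12 le23] := (ltnW t12, ltnW t23).
rewrite !catA cut// cut// -!catA cut'// cut'//.
rewrite !cat_take_drop -/(g t1) -/(g t2) -/(g t3) g1 g2 g3; split=> //.
  rewrite size_take size_drop; case: ifP => _; rewrite subn_gt0//.
  exact: leq_trans (ltn_trans t12 t23) t3l.
rewrite size_take size_drop; case: ifP => _; rewrite subn_gt0//.
exact: leq_trans t23 t3l.
Qed.

(** The index list [enum] is kept explicit, because rewriting the range of a
big operator to [i : 'I_k.+1] would require commutativity. *)
Lemma sgprod_big (T : Type) (one : T) (op : Monoid.law one) (k : nat)
    (s : 'I_k.+1 -> T) : sgprod op s = \big[op/one]_(i <- enum 'I_k.+1) s i.
Proof.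
have foldlE (r : seq T) x : foldl op x r = op x (\big[op/one]_(y <- r) y).
  elim: r x => [|y r IHr] x /=; first by rewrite big_nil Monoid.mulm1.
  by rewrite IHr big_cons Monoid.mulmA.
by rewrite /sgprod foldlE big_map enum_ordSl big_cons [in RHS]big_map.
Qed.

Lemma perm_of_seq (N : nat) (l : seq 'I_N) : uniq l -> size l = N ->
  exists sigma : 'S_N, [seq sigma i | i <- enum 'I_N] = l.
Proof.
case: N l => [|N] l ul sl.
  by exists 1%g; case: l sl ul => //; rewrite (size0nil (size_enum_ord 0)).
have inj : injective (fun i : 'I_N.+1 => nth ord0 l i).
  move=> i j /eqP; rewrite nth_uniq ?sl// => /eqP; exact: val_inj.
exists (perm inj); apply: (@eq_from_nth _ ord0).
  by rewrite size_map size_enum_ord.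
move=> i; rewrite size_map size_enum_ord => iN.
by rewrite (nth_map ord0) ?size_enum_ord// permE nth_enum_ord.
Qed.

(** The hypothesis on [u], [x], [y], [v] is exactly what three cuts with the
same classes of prefix and suffix provide: [c] is a colouring whose fibres
form a congruence, and colouring a cut by both classes needs
[#|{: C * C}|] colours. *)
Lemma strongly_permutable_of_swap (T : Type) (one : T) (op : Monoid.law one)
    (C : finType) (c : T -> C) :
  (forall a a' b b', c a = c a' -> c b = c b' -> c (op a b) = c (op a' b')) ->
  (forall u x y v, c (op u x) = c u -> c (op u y) = c u ->
     c (op x v) = c v -> c (op y v) = c v ->
     op u (op x (op y v)) = op u (op y (op x v))) ->
  strongly_permutable T op.
Proof.
move=> cM swap; exists (2 * #|{: C * C}|)%N => s.
set N := (_.+2); pose P l := \big[op/one]_(i <- l) s i.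
have PM l1 l2 : P (l1 ++ l2) = op (P l1) (P l2) by rewrite /P big_cat.
have size_le : (2 * #|{: C * C}| <= size (enum 'I_N))%N.
  by rewrite size_enum_ord /N !leqW.
have [u [x [y [v [eN x0 y0 [cux cyv] [cuxy cv]]]]]] :=
  three_equal_cuts (fun u v => (c (P u), c (P v))) size_le.
pose l := u ++ y ++ x ++ v.
have perm_l : perm_eq l (enum 'I_N).
  by rewrite eN perm_cat2l !catA perm_cat2r perm_catC.
have uniq_l : uniq l by rewrite (perm_uniq perm_l) enum_uniq.
have size_l : size l = N by rewrite (perm_size perm_l) size_enum_ord.
have [sigma sigmaE] := perm_of_seq uniq_l size_l.
exists sigma.
  (* Otherwise y ++ x = x ++ y, and the common head would occur twice. *)
  apply/eqP => sigma1; move: sigmaE.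
  rewrite sigma1; under eq_map do rewrite perm1.
  rewrite map_id eN /l => /eqP; rewrite eqseq_cat// eqxx /= => /eqP.
  have := enum_uniq 'I_N; rewrite eN cat_uniq => /and3P[_ _].
  case: x x0 {eN cux cyv cuxy cv l perm_l uniq_l size_l} => // a x _.
  case: y y0 => // b y _ /= /andP[+ _] [ab _].
  by rewrite ab mem_cat inE eqxx orbT.
rewrite !sgprod_big -[LHS](big_map sigma xpredT s) sigmaE eN -!/(P _) /l !PM.
move: cux cyv cuxy cv; rewrite !PM => cux cyv cuxy cv.
(* The cuts give u ~ u x ~ u x y and v ~ y v ~ x y v; by congruence
   u y ~ (u x) y ~ u and x v ~ x (y v) ~ v. *)
have cuy : c (op (P u) (P y)) = c (P u).
  by rewrite -[RHS]cuxy Monoid.mulmA; apply: cM.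
have cyv' : c (op (P y) (P v)) = c (P v) by rewrite cv cyv.
have cxv : c (op (P x) (P v)) = c (P v) by rewrite [RHS]cv; apply: cM.
by apply/esym/swap.
Qed.

(** * Truncated tropical scalars *)

Section Trop12Matrices.
Variable R : realType.
Implicit Types x y z : trop12 R.

Local Notation "x <=t y" := (trop12_val x%R <= trop12_val y%R)%E (at level 70).

Lemma trop12_addE x y : trop12_val (x + y) = maxe (trop12_val x) (trop12_val y).
Proof. by []. Qed.

Lemma trop12_mulE x y :
  trop12_val (x * y) = mine (trop12_val x + trop12_val y)%E 2%:E.
Proof. by []. Qed.

Variant trop12_spec x : Prop :=
  | Trop12Zero of x = 0
  | Trop12One of x = 1
  | Trop12Fin (r : R) of trop12_val x = r%:E & 1 <= r <= 2.

Lemma trop12P x : trop12_spec x.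
Proof.
have /or3P[/eqP e|/eqP e|] := trop12_valP x.
- by apply: Trop12Zero; apply: val_inj.
- by apply: Trop12One; apply: val_inj.
case e: (trop12_val x) => [r||] //; last by rewrite leye_eq andbF.
by rewrite !lee_fin => r12; apply: Trop12Fin r12.
Qed.

Lemma trop12_le2 x : (trop12_val x <= 2%:E)%E.
Proof.
case: (trop12P x) => [->|->|r -> /andP[_ ?]]; rewrite ?lee_fin//=.
exact: leNye.
Qed.

Lemma le_trop12_mul x x' y y' : x <=t x' -> y <=t y' -> x * y <=t x' * y'.
Proof.
move=> xx' yy'; rewrite !trop12_mulE le_min ge_min ge_min lexx orbT andbT.
by rewrite leeD.
Qed.

(** The unit [1] of the semiring is the real number 0, so [1 <=t y] says that
[y] is not -oo. *)
Lemma le_trop12_mulr x y : 1 <=t y -> x <=t x * y.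
Proof. by move=> y1; rewrite -[X in X <=t _]mulr1 le_trop12_mul. Qed.

Lemma le_trop12_mull x y : 1 <=t y -> x <=t y * x.
Proof. by rewrite mulrC; exact: le_trop12_mulr. Qed.

(** Whether a product reaches 2 depends on which factors reach 1, so the three
thresholds together are compatible with multiplication. *)
Definition level x : bool * bool * bool :=
  ((0 <= trop12_val x)%E, (1%:E <= trop12_val x)%E, (2%:E <= trop12_val x)%E).

Definition level_mul (p q : bool * bool * bool) : bool * bool * bool :=
  let: (p0, p1, p2) := p in let: (q0, q1, q2) := q in
  (p0 && q0, p1 && q0 || p0 && q1, [|| p2 && q0, p0 && q2 | p1 && q1]).

Lemma level_mulE x y : level (x * y) = level_mul (level x) (level y).
Proof.
have z0 : level 0 = (false, false, false) by [].
have one1 : level 1 = (true, false, false).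
  by rewrite /level/= lexx !lee_fin !leNgt ltr01 ltr0n.
have [->|->|r xE r12] := trop12P x; first by rewrite mul0r z0.
  by rewrite mul1r one1; case: (level y) => [[p q] t] /=; rewrite !orbF.
have [->|->|t yE t12] := trop12P y.
- by rewrite mulr0 z0; case: (level x) => [[? ?] ?] /=; rewrite !andbF.
- rewrite mulr1 one1; case: (level x) => [[p q] u] /=.
  by rewrite !andbT !andbF !orbF.
have xy2 : trop12_val (x * y) = 2%:E.
  by rewrite trop12_mulE xE yE -EFinD min_r// lee_fin; lra.
rewrite /level xy2 xE yE !lee_fin.
have [/andP[r1 _] /andP[t1 _]] := (r12, t12).
have -> : (0 <= r) by lra.
have -> : (0 <= t) by lra.
by rewrite r1 t1 lexx ler0n ler1n /= !orbT.
Qed.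

(** Two factors in [1, 2] multiply to 2, so a finite product below 2 has a
trivial factor. *)
Lemma trop12_mul_lt2_one x y :
  (0 <= trop12_val (x * y)%R < 2%:E)%E -> x = 1 \/ y = 1.
Proof.
have [->|->|r xE r12] := trop12P x; [by rewrite mul0r|by left|].
have [->|->|t yE t12] := trop12P y; [by rewrite mulr0|by right|].
rewrite trop12_mulE xE yE -EFinD min_r ?ltxx ?andbF// lee_fin.
lra.
Qed.

Lemma trop12_ge_sum (I : finType) (F : I -> trop12 R) (r : R) :
  (r%:E <= trop12_val (\sum_i F i)%R)%E =
  [exists i, (r%:E <= trop12_val (F i))%E].
Proof.
have -> : [exists i, (r%:E <= trop12_val (F i))%E] =
    \big[orb/false]_i (r%:E <= trop12_val (F i))%E by rewrite big_orE.
apply: (big_morph (fun x => (r%:E <= trop12_val x)%E)) => // x y.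
by rewrite trop12_addE le_max.
Qed.

(** * Profiles and the exchange of two factors *)

Variable n : nat.
Implicit Types A B U V X Y : 'M[trop12 R]_n.

Definition profile A : 'M[bool * bool * bool]_n := map_mx level A.

Lemma profileP A B : profile A = profile B ->
  forall i j, level (A i j) = level (B i j).
Proof. by move=> /matrixP AB i j; have := AB i j; rewrite !mxE. Qed.

Lemma profile_mul A A' B B' : profile A = profile A' ->
  profile B = profile B' -> profile (A * B) = profile (A' * B').
Proof.
move=> /profileP AA' /profileP BB'; apply/matrixP => i j; rewrite !mxE.
have AB k : level (A i k * B k j) = level (A' i k * B' k j).
  by rewrite !level_mulE AA' BB'.
rewrite /level !trop12_ge_sum; congr (_, _, _); apply: eq_existsb => k;
  by have [] := AB k.
Qed.

Lemma le_mul_entry A B i k j : A i k * B k j <=t (A * B) i j.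
Proof. by rewrite mxE (bigD1 k)//= le_max lexx. Qed.

Lemma le_mul_entryl A B i k j x :
  x <=t A i k -> 1 <=t B k j -> x <=t (A * B) i j.
Proof.
move=> xA B1; apply: le_trans (le_mul_entry A B i k j).
exact: le_trans xA (le_trop12_mulr _ B1).
Qed.

Lemma le_mul_entryr A B i k j x :
  1 <=t A i k -> x <=t B k j -> x <=t (A * B) i j.
Proof.
move=> A1 xB; apply: le_trans (le_mul_entry A B i k j).
exact: le_trans xB (le_trop12_mull _ A1).
Qed.

(** If the entry is below 2, then one of the two steps of a best walk has weight
0, so the other one carries the whole weight. In the second case the bound by
2 is kept, so that the search can go on in [B] when [B] is itself a product. *)
Lemma walk_step A B i j x : 1 <=t x -> x <=t (A * B) i j ->
  (trop12_val ((A * B)%R i j) < 2%:E)%E ->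
  exists k, (x <=t A i k /\ 1 <=t B k j) \/
    [/\ 1 <=t A i k, x <=t B k j & (trop12_val (B k j) < 2%:E)%E].
Proof.
move=> x1 xAB AB2.
have [k xk] : exists k, x <=t A i k * B k j.
  have [r xE] : exists r : R, trop12_val x = r%:E.
    have [x0|->|r rE _] := trop12P x; [|by exists 0|by exists r].
    by move: x1; rewrite x0 /= leeNy_eq.
  by move: xAB; rewrite xE mxE trop12_ge_sum => /existsP.
have k2 : (0 <= trop12_val (A i k * B k j)%R < 2%:E)%E.
  by rewrite (le_trans x1 xk) (le_lt_trans (le_mul_entry A B i k j) AB2).
exists k; have [e|e] := trop12_mul_lt2_one k2; move: xk k2; rewrite e.
  by rewrite mul1r => xk /andP[_ B2]; right.
by rewrite mulr1 => xk _; left.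
Qed.

(** An equality of matrices follows by exchanging the roles of [X] and [Y].
Following a best walk of the left product with [walk_step] locates the only
step whose weight may be nonzero; the profiles provide walks of weight at
least 0 before and after that step in the right product. *)
Lemma swap_le U X Y V :
  profile (U * X) = profile U -> profile (U * Y) = profile U ->
  profile (X * V) = profile V -> profile (Y * V) = profile V ->
  forall i j, (U * (X * (Y * V))) i j <=t (U * (Y * (X * V))) i j.
Proof.
move=> UX UY XV YV i j.
have ge0 A B k l : profile A = profile B -> 1 <=t A k l -> 1 <=t B k l.
  by move=> /profileP/(_ k l) [/= -> _ _].
have XYV : profile (X * (Y * V)) = profile V.
  by rewrite -[RHS]XV; apply: profile_mul.
have YXV : profile (Y * (X * V)) = profile V.
  by rewrite -[RHS]YV; apply: profile_mul.
have UXY : profile (U * X * Y) = profile U.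
  by rewrite -[RHS]UY; apply: profile_mul.
have UYX : profile (U * Y * X) = profile U.
  by rewrite -[RHS]UX; apply: profile_mul.
have total : profile (U * (X * (Y * V))) = profile (U * (Y * (X * V))).
  by apply: profile_mul; rewrite // XYV YXV.
set w := (U * (X * (Y * V))) i j.
have [w2|w2] := leP 2%:E%E (trop12_val w).
  apply: le_trans (trop12_le2 _) _.
  by have [_ _ <-] := profileP total i j.
have [w1|wN] : 1 <=t w \/ w = 0.
  have [->|->|r -> /andP[r1 _]] := trop12P w; [by right|by left|left].
  by rewrite lee_fin (le_trans ler01).
2: by rewrite wN leNye.
have [p [[wU XYVp]|[Up wp p2]]] := walk_step w1 (lexx (trop12_val w)) w2.
  by apply: le_mul_entryl wU (ge0 _ _ _ _ _ XYVp); rewrite XYV YXV.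
have [q [[wX YVq]|[Xq wq q2]]] := walk_step w1 wp p2.
  rewrite mulrA; apply: le_mul_entryr (ge0 _ _ _ _ (esym UY) Up) _.
  exact: le_mul_entryl wX (ge0 _ _ _ _ YV YVq).
have [r [[wY Vr]|[Yr wr _]]] := walk_step w1 wq q2.
  apply: le_mul_entryr (ge0 _ _ _ _ UX (le_mul_entryl Up Xq)) _.
  exact: le_mul_entryl wY (ge0 _ _ _ _ (esym XV) Vr).
rewrite !mulrA; apply: le_mul_entryr wr; apply: (ge0 (U * X * Y)).
  by rewrite UXY.
exact: le_mul_entryl (le_mul_entryl Up Xq) Yr.
Qed.

End Trop12Matrices.

Theorem theorem4p3 (R : realType) (n : nat) (n_gt0 : (0 < n)%N) :
  strongly_permutable 'M[trop12 R]_n *%R.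
Proof.
apply: (strongly_permutable_of_swap (c := @profile R n)).
  exact: profile_mul.
move=> U X Y V UX UY XV YV; apply/matrixP => i j; apply: val_inj.
by apply/eqP; rewrite eq_le !swap_le.
Qed.
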